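(* Let $\varepsilon\in(0,\tfrac12]$ and $a\ge1$, and let $G$ be a graph with $\chi(G)\ge\varepsilon^{-3a^2}$. Let $x:=\varepsilon^{3a}$. Assume that every induced subgraph $F$ of $G$ with $\chi(F)\ge\varepsilon^a\chi(G)$ contains a blockade $(B_1,\ldots,B_k)$ which is pure or $(x,\chi)$-dense, with $k\in[2,x^{-1}]$ and $\chi(B_i)\ge k^{-a}\chi(F)$ for all $i\in\{1,\ldots,k\}$. Then $G$ contains a blockade $(A_1,\ldots,A_\ell)$ with $\ell\ge\varepsilon^{-1}$ and $\chi(A_i)\ge x^{2a}\chi(G)$ for all $i\in\{1,\ldots,\ell\}$, such that for all $i<j$, $A_j$ is either anticomplete to $A_i$ or $(\varepsilon^a,\chi)$-dense to $A_i$.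
   Context: Graphs are finite and simple. For $S\subseteq V(G)$, $\chi(S)=\chi(G[S])$; $N_G(v)$ is the neighbourhood of $v$. A blockade is a sequence of pairwise disjoint subsets of $V(G)$. For disjoint $A,B$, $A$ is anticomplete to $B$ if there are no edges between them; $(A,B)$ is complete if every vertex of $A$ is adjacent to every vertex of $B$; a pair is pure if complete or anticomplete. A blockade is pure if every pair of distinct blocks is pure. For disjoint $A,B$, $B$ is $(\varepsilon,\chi)$-dense to $A$ if $\chi(A\setminus N_G(v))<\varepsilon\chi(A)$ for all $v\in B$; a blockade $(B_1,\ldots,B_k)$ is $(\varepsilon,\chi)$-dense if $B_j$ is $(\varepsilon,\chi)$-dense to $B_i$ for all $i<j$. *)

(* Defs.v *)
From mathcomp Require Import all_boot all_order all_algebra.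
From mathcomp Require Import all_classical all_reals all_analysis.

Set Implicit Arguments.
Unset Strict Implicit.
Unset Printing Implicit Defensive.

Import Order.TTheory GRing.Theory Num.Theory.

Local Open Scope ring_scope.

Record sgraph := SGraph {
  vertex :> finType;
  adj : rel vertex;
  adj_sym : symmetric adj;
  adj_irrefl : irreflexive adj }.

Section Induced.
Variables (G : sgraph) (S : {set G}).

Definition induced_adj : rel {v : G | v \in S} :=
  fun u v => adj (val u) (val v).

Lemma induced_adj_sym : symmetric induced_adj.
Proof. by move=> u v; exact: adj_sym. Qed.

Lemma induced_adj_irrefl : irreflexive induced_adj.
Proof. by move=> u; exact: adj_irrefl. Qed.

Definition induced : sgraph := SGraph induced_adj_sym induced_adj_irrefl.

End Induced.

Definition colorable (G : sgraph) (k : nat) : bool :=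
  [exists f : {ffun G -> 'I_k}, [forall u, forall v, adj u v ==> (f u != f v)]].

Lemma colorable_card (G : sgraph) : exists k, colorable G k.
Proof.
exists #|G|; apply/existsP; exists [ffun v : G => enum_rank v].
apply/forallP => u; apply/forallP => v; apply/implyP => uv.
rewrite !ffunE (inj_eq enum_rank_inj).
by apply: contraTneq uv => ->; rewrite adj_irrefl.
Qed.

Definition chromatic_number (G : sgraph) : nat := ex_minn (colorable_card G).

Section Blockades.
Variable G : sgraph.
Implicit Types (A B S : {set G}) (v : G).

Definition chi S : nat := chromatic_number (induced S).

Definition neighbourhood v : {set G} := [set u | adj v u].

Definition anticomplete A B : Prop :=
  forall u v, u \in A -> v \in B -> ~~ adj u v.

Definition complete A B : Prop :=
  forall u v, u \in A -> v \in B -> adj u v.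

Definition pure_pair A B : Prop := complete A B \/ anticomplete A B.

(* [B] is (eps, chi)-dense to [A]. *)
Definition dense_to (R : realType) (eps : R) B A : Prop :=
  forall v, v \in B -> (chi (A :\: neighbourhood v))%:R < eps * (chi A)%:R.

(* The blocks are indexed by 0, ..., k - 1; a block may be empty. *)
Definition blockade k (B : 'I_k -> {set G}) : Prop :=
  forall i j, i != j -> [disjoint B i & B j].

Definition pure_blockade k (B : 'I_k -> {set G}) : Prop :=
  forall i j, i != j -> pure_pair (B i) (B j).

Definition dense_blockade (R : realType) (eps : R) k
    (B : 'I_k -> {set G}) : Prop :=
  forall i j : 'I_k, (i < j)%N -> dense_to eps (B j) (B i).

End Blockades.

(* Main.v *)
Require Import Defs.
From mathcomp Require Import all_boot all_order all_algebra.
From mathcomp Require Import all_classical all_reals all_analysis.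
From mathcomp Require Import ring lra.

(** Repeatedly replace a block $A$ with $\chi(A)\ge\varepsilon^a\chi(G)$ by the blockade that the
hypothesis provides inside it. If some such blockade has at least $1/\varepsilon$ blocks, it is
already as required. Otherwise every block that arises has chromatic number at least
$\varepsilon^{2a}\chi(G)$, so a bound by $x\chi(G)$ on the non-neighbours inside a block, which
survives passing to subsets, yields $(\varepsilon^a,\chi)$-density. The sum of $\chi(A)^{1/a}$
over the blocks never decreases, hence as long as there are fewer than $1/\varepsilon$ blocks,
one of them can be refined. *)

Set Implicit Arguments.
Unset Strict Implicit.
Unset Printing Implicit Defensive.

Import Order.TTheory GRing.Theory Num.Theory.

Local Open Scope ring_scope.

Lemma colorableP (G : sgraph) (k : nat) :
  reflect (exists f : G -> 'I_k, forall u v, adj u v -> f u != f v)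
          (colorable G k).
Proof.
apply: (iffP existsP) => [[f /forallP fP]|[f fP]].
  by exists f => u v uv; move: (fP u) => /forallP /(_ v) /implyP; apply.
exists (finfun f); apply/forallP => u; apply/forallP => v; apply/implyP => uv.
by rewrite !ffunE fP.
Qed.

(** An optimal colouring of [H] pulls back along [h]. *)
Lemma chromatic_number_hom (G H : sgraph) (h : G -> H) :
  (forall u v, adj u v -> adj (h u) (h v)) ->
  (chromatic_number G <= chromatic_number H)%N.
Proof.
move=> hP; rewrite {2}/chromatic_number; case: ex_minnP => k /colorableP[f fP] _.
rewrite /chromatic_number; case: ex_minnP => m _; apply.
by apply/colorableP; exists (f \o h) => u v uv; apply/fP/hP.
Qed.

Lemma chi_subset (G : sgraph) (A B : {set G}) :
  A \subset B -> (chi A <= chi B)%N.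
Proof.
move=> /fintype.subsetP sAB.
by apply: (@chromatic_number_hom (Defs.induced A) (Defs.induced B)
  (fun u : {v : G | v \in A} => exist _ (val u) (sAB _ (valP u)) : {v : G | v \in B})).
Qed.

Lemma chi_setT (G : sgraph) : chi [set: G] = chromatic_number G.
Proof.
apply/eqP; rewrite eqn_leq; apply/andP; split.
  by apply: (@chromatic_number_hom (Defs.induced [set: G]) G
    (fun u : {v : G | v \in [set: G]} => val u)).
by apply: (@chromatic_number_hom G (Defs.induced [set: G])
  (fun u => exist _ u (finset.in_setT u) : {v : G | v \in [set: G]})).
Qed.

Lemma chi_set0 (G : sgraph) : chi (finset.set0 : {set G}) = 0%N.
Proof.
rewrite /chi /chromatic_number; case: ex_minnP => m _ minm.
apply/eqP; rewrite -leqn0; apply: minm; apply/colorableP.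
have no (u : Defs.induced (finset.set0 : {set G})) : False.
  by move: (valP u); rewrite finset.in_set0.
by exists (fun u => False_rect _ (no u)) => u; case: (no u).
Qed.

(** This lets a complete pair count as dense, for any positive bound on the non-neighbours. *)
Lemma chi_complete (G : sgraph) (A B : {set G}) (v : G) :
  Defs.complete A B -> v \in B -> chi (A :\: neighbourhood v) = 0%N.
Proof.
move=> cAB vB; suff -> : A :\: neighbourhood v = finset.set0 by exact: chi_set0.
apply/finset.setP => u; rewrite !finset.inE; case: (boolP (u \in A)) => uA; rewrite ?andbF //.
by rewrite adj_sym (cAB _ _ uA vB).
Qed.

Lemma pairwise_map_enum_ord (T : Type) (r : rel T) (k : nat) (f : 'I_k -> T) :
  (forall i j : 'I_k, (i < j)%N -> r (f i) (f j)) ->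
  pairwise r [seq f i | i <- enum 'I_k].
Proof.
move=> fr; rewrite pairwise_map.
have : pairwise (relpre val ltn) (enum 'I_k).
  by rewrite -pairwise_map val_enum_ord -sorted_pairwise ?iota_ltn_sorted //; exact: ltn_trans.
by apply: sub_pairwise => i j /=; exact: fr.
Qed.

(** The bound [d] is absolute rather than a fraction of $\chi(A)$, so that it survives shrinking
    [A]. Disjointness is built in so that one relation, boolean for the sake of [pairwise], carries
    the whole invariant. *)
Definition sparse_or_anticomplete (G : sgraph) (R : realType) (d : R)
    (A B : {set G}) : bool :=
  [disjoint A & B] &&
  `[< anticomplete B A \/
      forall v, v \in B -> (chi (A :\: neighbourhood v))%:R < d >].

Lemma sparse_or_anticomplete_sub (G : sgraph) (R : realType) (d : R)
    (A A' B B' : {set G}) :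
  A' \subset A -> B' \subset B ->
  sparse_or_anticomplete d A B -> sparse_or_anticomplete d A' B'.
Proof.
move=> sA sB /andP[dAB /asboolP H]; apply/andP; split.
  exact: disjointWl sA (disjointWr sB dAB).
apply/asboolP; case: H => H; [left|right].
  by move=> u v uB vA; apply: H; [exact: (fintype.subsetP sB)|exact: (fintype.subsetP sA)].
move=> v vB; apply: le_lt_trans (H v (fintype.subsetP sB _ vB)).
by rewrite ler_nat chi_subset // finset.setSD.
Qed.

(** Since [r] is inherited downwards along [le] (inclusion, in the application), the members of [t]
    take over from [A] its relations to [s1] and [s2]. *)
Lemma pairwise_refine (T : eqType) (r le : rel T) (s1 s2 t : seq T) (A : T) :
  (forall u, u \in t -> le u A) -> reflexive le ->
  (forall u u' v v', le u' u -> le v' v -> r u v -> r u' v') ->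
  pairwise r (s1 ++ A :: s2) -> pairwise r t -> pairwise r (s1 ++ t ++ s2).
Proof.
move=> tA lexx mono.
rewrite !pairwise_cat /= allrel_consr => /and3P[/andP[/allP s1A s12] ps1 /andP[/allP As2 ps2]] pt.
rewrite allrel_catr s12 ps1 pt ps2 !andbT /=; apply/andP; split.
  apply/allrelP => u v us vt; exact: mono (lexx u) (tA v vt) (s1A u us).
apply/allrelP => u v ut vs; exact: mono (tA u ut) (lexx v) (As2 v vs).
Qed.

(** Each summand is at least $c^{1/a}/k$. Hence splitting a block does not lower the sum of
    $\chi^{1/a}$. *)
Lemma powR_mean_le (R : realType) (a : R) (k : nat) (b : 'I_k -> R) (c : R) :
  0 < a -> 0 <= c -> (0 < k)%N ->
  (forall i, k%:R `^ (- a) * c <= b i) ->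
  c `^ a^-1 <= \sum_(i < k) b i `^ a^-1.
Proof.
move=> a0 c0 k0 H.
have -> : c `^ a^-1 = \sum_(i < k) (k%:R `^ (- a) * c) `^ a^-1.
  rewrite sumr_const card_ord powRM ?powR_ge0 // -powRrM mulNr divff ?gt_eqF //.
  by rewrite powR_inv1 ?ler0n // -[RHS]mulr_natl mulrA divff ?mul1r // pnatr_eq0 -lt0n.
apply: ler_sum => i _; apply: ge0_ler_powR => //.
- by rewrite invr_ge0 ltW.
- by rewrite nnegrE mulr_ge0 ?powR_ge0.
- by rewrite nnegrE (le_trans _ (H i)) // mulr_ge0 ?powR_ge0.
Qed.

(** Turns a bound on the number of blocks into one on the factor $k^{-a}$; applied with $y=x$ and
    with $y=\varepsilon$. *)
Lemma powR_inv_le (R : realType) (a y n : R) :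
  0 <= a -> 0 < y -> 0 < n -> n <= y^-1 -> y `^ a <= n `^ (- a).
Proof.
move=> a0 y0 n0 ny; rewrite powRN -lef_pV2 ?posrE ?invr_gt0 ?powR_gt0 // invrK.
rewrite -powRN (_ : y `^ (- a) = y^-1 `^ a); last first.
  by rewrite -powR_inv1 ?ltW // -powRrM mulN1r.
by apply: ge0_ler_powR => //; rewrite nnegrE ltW // invr_gt0.
Qed.

(** If all weights were below $\varepsilon^a c$, every summand would be at most $\varepsilon
    c^{1/a}$, and fewer than $1/\varepsilon$ of them would total less than $c^{1/a}$. *)
Lemma exists_large_block (R : realType) (T : eqType) (w : T -> R) (a eps c : R)
    (s : seq T) :
  0 < a -> 0 < eps -> 0 < c -> (forall A, 0 <= w A) -> (size s)%:R < eps^-1 ->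
  c `^ a^-1 <= \sum_(A <- s) w A `^ a^-1 ->
  exists2 A, A \in s & eps `^ a * c <= w A.
Proof.
move=> a0 e0 c0 w0 sz pot; apply/hasP; apply: contraLR pot => /hasPn small.
rewrite -ltNge; apply: (@le_lt_trans _ _ (\sum_(A <- s) eps * c `^ a^-1)).
  rewrite big_seq [leRHS]big_seq; apply: ler_sum => A /small; rewrite -ltNge => wA.
  have -> : eps * c `^ a^-1 = (eps `^ a * c) `^ a^-1.
    by rewrite powRM ?powR_ge0 ?ltW // -powRrM divff ?gt_eqF // powRr1 // ltW.
  apply: ge0_ler_powR; rewrite ?nnegrE ?(ltW wA) ?w0 //.
  - by rewrite invr_ge0 ltW.
  - by rewrite mulr_ge0 ?powR_ge0 // ltW.
rewrite big_const_seq count_predT iter_addr_0 -[ltLHS]mulr_natl mulrA.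
by rewrite gtr_pMl ?powR_gt0 // -ltr_pdivlMr // div1r.
Qed.

Theorem theorem6p1 (R : realType) (eps a x : R) (G : sgraph)
  (heps0 : 0 < eps) (heps2 : eps <= 2^-1) (ha : 1 <= a)
  (hG : eps `^ (- (3 * a ^+ 2)) <= (chromatic_number G)%:R)
  (hx : x = eps `^ (3 * a))
  (hF : forall F : {set G},
    eps `^ a * (chromatic_number G)%:R <= (chi F)%:R ->
    exists (k : nat) (B : 'I_k -> {set G}),
      [/\ blockade B,
          forall i, B i \subset F,
          pure_blockade B \/ dense_blockade x B,
          (2 <= k)%N /\ k%:R <= x^-1
        & forall i, k%:R `^ (- a) * (chi F)%:R <= (chi (B i))%:R]) :
  exists (l : nat) (A : 'I_l -> {set G}),
    [/\ blockade A,
        eps^-1 <= l%:R,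
        forall i, x `^ (2 * a) * (chromatic_number G)%:R <= (chi (A i))%:R
      & forall i j : 'I_l, (i < j)%N ->
          anticomplete (A j) (A i) \/ dense_to (eps `^ a) (A j) (A i)].
Proof.
have a0 : 0 < a by exact: lt_le_trans ha.
have eps1 : eps <= 1 by lra.
set c : R := (chromatic_number G)%:R in hG hF *.
have c0 : 0 < c by apply: lt_le_trans hG; exact: powR_gt0.
have epsle u v : v <= u -> eps `^ u <= eps `^ v.
  by move=> uv; apply: ger_powR => //; rewrite heps0.
have ca0 : 0 <= eps `^ a * c by rewrite mulr_ge0 ?powR_ge0 ?ltW.
have x0 : 0 < x by rewrite hx powR_gt0.
(* The factorisation behind the choice of $\varepsilon^{2a}c$ as lower bound for blocks: with it,
   $xc\le\varepsilon^a\chi(A)$. *)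
have xE : x = eps `^ a * eps `^ (2 * a).
  by rewrite hx -powRD ?(gt_eqF heps0) ?implybT //; congr (_ `^ _); ring.
have chic (S : {set G}) : (chi S)%:R <= c.
  by rewrite /c ler_nat -chi_setT chi_subset // finset.subsetT.
have a2 : a <= a * a by rewrite ler_peMr // ltW.
have xle : x <= eps `^ a by rewrite hx; apply: epsle; lra.
have x2a : x `^ (2 * a) <= eps `^ (2 * a).
  by rewrite hx -powRrM; apply: epsle; nra.
(* In exponents of $\varepsilon$: $6a^2\ge 3a^2+a$, as $a\ge1$. *)
have x2a' : x `^ (2 * a) <= x `^ a * eps `^ a.
  rewrite hx -!powRrM -powRD ?(gt_eqF heps0) ?implybT //; apply: epsle; nra.
(* Arguing by contradiction lets the induction in [grow] discard every situation in which the
   required blockade already exists. *)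
apply: contrapT => nogoal.
have enough (s : seq {set G}) : eps^-1 <= (size s)%:R ->
    pairwise (sparse_or_anticomplete (x * c)) s ->
    (forall A, A \in s -> eps `^ (2 * a) * c <= (chi A)%:R) -> False.
  move=> ge ps large.
  case: nogoal; exists (size s), (fun i => nth finset.set0 s i).
  have rP (i j : 'I_(size s)) : (i < j)%N ->
      sparse_or_anticomplete (x * c) (nth finset.set0 s i) (nth finset.set0 s j).
    by move=> ij; move/(pairwiseP finset.set0): ps; apply; rewrite ?inE.
  have lP (i : 'I_(size s)) := large _ (mem_nth finset.set0 (ltn_ord i)).
  split => // [i j|i|i j ij].
  - by rewrite neq_ltn => /orP[] /rP /andP[]; rewrite 1?disjoint_sym.
  - by apply: le_trans (lP i); rewrite ler_wpM2r // ltW.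
  - have /andP[_ /asboolP[|H]] := rP _ _ ij; [by left|right=> v vB].
    apply: lt_le_trans (H v vB) _; rewrite xE -mulrA.
    by rewrite ler_wpM2l ?powR_ge0.
(* Each step trades one block for $k\ge2$ blocks, so the length is unbounded, against [enough]. The
   last conjunct is the potential that guarantees a block to refine. *)
have grow n : exists s : seq {set G},
    [/\ (n <= size s)%N, pairwise (sparse_or_anticomplete (x * c)) s,
        forall A, A \in s -> eps `^ (2 * a) * c <= (chi A)%:R
      & c `^ a^-1 <= \sum_(A <- s) (chi A)%:R `^ a^-1].
  elim: n => [|n [s [szs ps large pot]]].
    exists [:: finset.setT]; split => //=; last by rewrite big_seq1 chi_setT.
    move=> A; rewrite mem_seq1 => /eqP ->; rewrite chi_setT -/c ger_pMl //.
    by rewrite -[leRHS](powRr0 eps); apply: epsle; lra.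
  have [ge|lt] := leP eps^-1 (size s)%:R; first by case: (enough s).
  have [A As cA] := exists_large_block a0 heps0 c0 (fun A => ler0n R (chi A)) lt pot.
  have [k [B [bB sB pdB [k2 kx] chiB]]] := hF A cA.
  have k0 : (0 < k%:R :> R) by rewrite ltr0n ltnW.
  have [ge|klt] := leP eps^-1 (k%:R : R).
    have Bl i : x `^ (2 * a) * c <= (chi (B i))%:R.
      (* As $k\le x^{-1}$, $\chi(B_i)\ge k^{-a}\chi(A)\ge x^a\varepsilon^a c\ge x^{2a}c$. *)
      apply: le_trans (chiB i); apply: (@le_trans _ _ (x `^ a * (eps `^ a * c))).
        by rewrite mulrA ler_wpM2r // ltW.
      apply: ler_pM cA; rewrite ?powR_ge0 //.
      by apply: powR_inv_le; rewrite ?(ltW a0).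
    case: nogoal; exists k, B; split => // i j ij.
    (* Density is a strict inequality, so a complete pair needs $\chi(B_i)>0$. *)
    have chi0 : (0 : R) < (chi (B i))%:R.
      by apply: lt_le_trans (Bl i); rewrite mulr_gt0 ?powR_gt0.
    case: pdB => [pB|dB].
      have nij : i != j by rewrite neq_ltn ij.
      case: (pB i j nij) => [cB|aB].
        by right=> v vB; rewrite (chi_complete cB vB) mulr_gt0 ?powR_gt0.
      by left=> u v uB vB; rewrite adj_sym aB.
    right=> v vB; apply: lt_le_trans (dB i j ij v vB) _.
    by rewrite ler_wpM2r.
  (* Here $k<1/\varepsilon$ costs one factor $\varepsilon^a$ and the choice of [A] another; the
     bound does not decay with the number of refinements. *)
  have Bl i : eps `^ (2 * a) * c <= (chi (B i))%:R.
    apply: le_trans (chiB i).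
    have -> : eps `^ (2 * a) = eps `^ a * eps `^ a.
      by rewrite -powRD ?(gt_eqF heps0) ?implybT //; congr (_ `^ _); ring.
    rewrite -mulrA; apply: ler_pM cA; rewrite ?powR_ge0 //.
    by apply: powR_inv_le; rewrite ?(ltW a0) ?(ltW klt).
  case/splitPr: As szs ps large pot lt => s1 s2 szs ps large pot _.
  exists (s1 ++ [seq B i | i <- enum 'I_k] ++ s2); split.
  - move: szs; rewrite !size_cat /= size_map size_enum_ord !addnS => h; apply: leq_ltn_trans h _.
    by rewrite addnCA -addn2 addnC leq_add2r.
  - apply: (pairwise_refine (le := fun A B : {set G} => A \subset B) _ _ _ ps).
    + by move=> _ /mapP[i _ ->].
    + by move=> D.
    + by move=> D D' E E'; exact: sparse_or_anticomplete_sub.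
    apply: pairwise_map_enum_ord => i j ij; have nij : i != j by rewrite neq_ltn ij.
    apply/andP; split; first exact: bB.
    apply/asboolP; case: pdB => [pB|dB].
      case: (pB i j nij) => [cB|aB].
        by right=> v vB; rewrite (chi_complete cB vB) mulr_gt0.
      by left=> u v uB vB; rewrite adj_sym aB.
    (* Relative density becomes the absolute bound: $x\chi(B_i)\le xc$. *)
    right=> v vB; apply: lt_le_trans (dB i j ij v vB) _.
    by rewrite ler_wpM2l ?chic ?(ltW x0).
  - move=> D; rewrite !mem_cat => /or3P[Ds|/mapP[i _ ->]|Ds]; [|exact: Bl|].
      by apply: large; rewrite mem_cat Ds.
    by apply: large; rewrite mem_cat inE Ds !orbT.
  apply: le_trans pot _; rewrite !big_cat big_cons /= lerD2l lerD2r.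
  by rewrite big_map big_enum; apply: powR_mean_le => //; exact: ltnW.
have [s [szs ps large pot]] := grow (Num.truncn eps^-1).+1.
apply: (enough s) => //; apply: ltW; apply: lt_le_trans (truncnS_gt _) _.
by rewrite ler_nat.
Qed.
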